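(* There is a constant $C<\infty$ such that the following holds. Let $h>0$, $r>0$, let $u,\tilde u\in C^\infty(\mathbb{R})$, let $\lambda,\tilde\lambda\in\mathbb{R}$ with $|\lambda-\frac12|<\frac18$, let $\chi=\mathbf 1_{\{u>\lambda\}}$, $\tilde\chi=\mathbf 1_{\{\tilde u>\tilde\lambda\}}$, and let $\eta\in C_0^\infty(-2r,2r)$ be a radially non-increasing cut-off for $(-r,r)$ inside $(-2r,2r)$. Then for any $0<s<\frac1C$, $$\frac1{\sqrt h}\int\eta\,|\chi-\tilde\chi|\,dx\le C\left(\frac1{\sqrt h}\int_{\{\frac13\le u\le\frac23\}}\eta\,\big(\sqrt h\,\partial_1u-\overline c\big)_-^2\,dx+s+\frac1{s^2}\frac1{\sqrt h}\int\eta\,(u-\tilde u)^2\,dx+\frac r{s^2}\frac{(\lambda-\tilde\lambda)^2}{\sqrt h}\right).$$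
   Context: Integrals are over $\mathbb{R}$; $\partial_1u=u'$; $(a)_-=\max\{-a,0\}$. The cut-off $\eta$ satisfies $0\le\eta\le1$, $\eta=1$ on $(-r,r)$, and is supported in $(-2r,2r)$, and $\eta(x)$ is a non-increasing function of $|x|$. $\overline c>0$ is a fixed universal constant, chosen such that the first integrand vanishes when $u$ is the convolution of the one-dimensional heat kernel $\frac1{\sqrt{4\pi h}}e^{-z^2/(4h)}$ with the (increasing) characteristic function of a half line. *)

(* Defs.v *)
From HB Require Import structures.
From mathcomp Require Import all_boot all_order all_algebra.
From mathcomp Require Import all_classical all_reals all_analysis.

Set Implicit Arguments.
Unset Strict Implicit.
Unset Printing Implicit Defensive.

Import Order.TTheory GRing.Theory Num.Theory.
Import numFieldNormedType.Exports.

Local Open Scope classical_set_scope.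
Local Open Scope ring_scope.

Definition smooth (R : realType) (f : R -> R) : Prop :=
  forall (n : nat) (x : R), derivable (derive1n n f) x 1.

(* eta in C_0^oo(-2r,2r): the topological support, a closed set, is contained
   in the open interval, hence compact. *)
Definition radial_cutoff (R : realType) (r : R) (eta : R -> R) : Prop :=
  [/\ smooth eta,
      closure [set x | eta x != 0] `<=` `](- (2 * r)), (2 * r)[,
      forall x : R, 0 <= eta x <= 1,
      forall x : R, - r < x < r -> eta x = 1 &
      forall x y : R, `|x| <= `|y| -> eta y <= eta x].

Definition midrange (R : realType) (u : R -> R) : set R :=
  [set x | 3^-1 <= u x <= 2 / 3].

Definition slope_defect (R : realType) (cbar h : R) (u : R -> R) : R -> R :=
  (fun x => Num.sqrt h * derive1 u x - cbar)^\-.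

Definition heat_kernel (R : realType) (h z : R) : R :=
  (Num.sqrt (4 * pi * h))^-1 * expR (- (z ^+ 2 / (4 * h))).

Definition heat_half_line (R : realType) (h a x : R) : R :=
  (\int[lebesgue_measure]_y
     (heat_kernel h (x - y) * \1_[set z : R | a < z] y))%R.

(* The constant is only pinned down by the requirement that the defect vanish
   on the middle range of every mollified half line; all constants with this
   property are admissible. *)
Definition admissible_slope (R : realType) (cbar : R) : Prop :=
  0 < cbar /\
  forall (h a x : R), 0 < h -> midrange (heat_half_line h a) x ->
    slope_defect cbar h (heat_half_line h a) x ^+ 2 = 0.

(* Main.v *)
(* Off the layer [|u - lam| < s] a disagreement of the two characteristic
   functions forces [s <= |u - ut| + |lam - lamt|], and Chebyshev's inequality
   gives the last two terms. On the layer, writing [D] for the defect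
   [(sqrt h u' - cbar)_-], AM-GM gives
   [1 <= (2 / cbar) sqrt h u' + D ^ 2 / cbar ^ 2]. With the indicator of the
   layer replaced by a continuous [phi(u)], the term [eta phi(u) u'] is
   [eta F(u)'] with [F' = phi] and [F = O(s)]; integrating by parts against the
   radially monotone [eta], whose total variation is 2, bounds its integral by
   [O(s)] however often [u] crosses the layer. *)

Require Import Defs.
From HB Require Import structures.
From mathcomp Require Import all_boot all_order all_algebra.
From mathcomp Require Import all_classical all_reals all_analysis.
From mathcomp Require Import measurable_realfun lra ring.
Import Order.TTheory GRing.Theory Num.Theory.
Import numFieldNormedType.Exports.
Local Open Scope classical_set_scope.
Local Open Scope ring_scope.

(** * A trapezoidal bump and its primitive *)

(** Away from 0 the function is plus or minus a square; at 0 the difference quotient is the norm of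
    the increment, which tends to 0. This gives primitives of piecewise linear functions written
    with absolute values. *)
Lemma is_derive_mul_norm {R : realType} (x : R) :
  is_derive x 1 (fun y : R => y * `|y|) (2 * `|x|).
Proof.
have [x0|x0|->] := ltgtP x 0.
- apply: (@near_eq_is_derive _ _ _ (fun y : R => - (y * y))).
    near=> y.
    have y0 : y < 0 by near: y; exact: lt_nbhsl.
    by rewrite ltr0_norm// mulrN.
  apply: is_derive_eq.
  rewrite ltr0_norm//= /GRing.scale/=; ring.
- apply: (@near_eq_is_derive _ _ _ (fun y : R => y * y)).
    near=> y.
    have y0 : 0 < y by near: y; exact: lt_nbhsr.
    by rewrite gtr0_norm.
  apply: is_derive_eq.
  rewrite gtr0_norm//= /GRing.scale/=; ring.
- rewrite normr0 mulr0.
  pose q (y : R) := y * `|y|.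
  have q0 : (fun h : R => h^-1 *: (q (h *: (1 : R) + 0) - q 0)) @ (0 : R)^' --> (0 : R).
    apply: (@cvg_trans _ ((Num.norm : R -> R) @ (0 : R)^')).
      apply: near_eq_cvg; near=> h.
      have h0 : h != 0 by near: h; exact: nbhs_dnbhs_neq.
      by rewrite /q /GRing.scale/= !mulr1 !addr0 mul0r subr0 mulKf.
    apply: cvg_within_filter.
    by have := @norm_continuous R R 0; rewrite /continuous_at normr0.
  apply: DeriveDef; last by rewrite /derive; exact/cvg_lim.
  by apply/cvg_ex; exists 0; exact: q0.
Unshelve. all: by end_near. Qed.

(* Trapezoid: equal to [1] on [-1, 1] and to [0] off [-2, 2]. *)
Definition plateau {R : realType} (t : R) : R :=
  2^-1 * (`|t + 2| - `|t + 1| - `|t - 1| + `|t - 2|).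

(** Each absolute value of [t + a] in [plateau] is replaced by its odd primitive, half of [t + a]
    times its norm; the sum is an odd function of [t]. *)
Definition plateau_primitive {R : realType} (t : R) : R :=
  4^-1 * ((t + 2) * `|t + 2| - (t + 1) * `|t + 1|
          - (t - 1) * `|t - 1| + (t - 2) * `|t - 2|).

Ltac norm_cases t :=
  case: (ger0P (t + 2)) => ?; case: (ger0P (t + 1)) => ?;
  case: (ger0P (t - 1)) => ?; case: (ger0P (t - 2)) => ?.

Lemma plateau_ge0 {R : realType} (t : R) : 0 <= plateau t.
Proof. rewrite /plateau; norm_cases t; lra. Qed.

Lemma plateau_le1 {R : realType} (t : R) : plateau t <= 1.
Proof. rewrite /plateau; norm_cases t; lra. Qed.

Lemma plateau1 {R : realType} (t : R) : `|t| <= 1 -> plateau t = 1.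
Proof. rewrite ler_norml => /andP[? ?]; rewrite /plateau; norm_cases t; lra. Qed.

Lemma plateau0 {R : realType} (t : R) : 2 <= `|t| -> plateau t = 0.
Proof.
rewrite ler_normr => /orP[] ?; rewrite /plateau; norm_cases t; lra.
Qed.

Lemma plateau_continuous {R : realType} : continuous (@plateau R).
Proof.
move=> t; apply: cvgMr.
do !apply: cvgD; do ?apply: cvgN; apply: cvg_norm; apply: cvgD;
  by [exact: cvg_id|exact: cvg_cst].
Qed.

(** The trapezoid has area 3, so its odd primitive increases from -3/2 to 3/2. *)
Lemma plateau_primitive_bound {R : realType} (t : R) :
  `|plateau_primitive t| <= 3 / 2.
Proof.
rewrite ler_norml /plateau_primitive; apply/andP; norm_cases t; split; try lra; nra.
Qed.

Lemma is_derive_plateau_primitive {R : realType} (t : R) :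
  is_derive t 1 (@plateau_primitive R) (plateau t).
Proof.
have shiftq (a : R) : is_derive t 1 (fun y : R => (y + a) * `|y + a|) (2 * `|t + a|).
  have := @is_derive1_comp R (fun y : R => y * `|y|) (shift a) t _ _
    (is_derive_mul_norm (t + a)) (is_derive_shift t 1 a).
  by rewrite mulr1.
have := is_deriveZ 4^-1 (is_deriveD (is_deriveB (is_deriveB
  (shiftq 2) (shiftq 1)) (shiftq (- 1))) (shiftq (- 2))).
by move/is_derive_eq; apply; rewrite /plateau /GRing.scale/=; lra.
Qed.

(** * Signs of derivatives and integration on intervals *)

(** Only points on one side of [x] are compared, so the lemma and its mirror image apply to a
    radially non-increasing function on each closed half line, the origin included. *)
Lemma is_derive_le0_right {R : realType} (f : R -> R) (x df : R) :
  is_derive x 1 f df -> (forall y, x < y -> f y <= f x) -> df <= 0.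
Proof.
move=> fdf fle.
have [/cvg_ex[l fl] fdfE] := fdf.
have ldf : l = df by rewrite -fdfE; apply/esym/cvg_lim.
have /cvg_dnbhs_at_right fl' := fl.
rewrite -ldf -(cvg_lim _ fl')//; apply: limr_le; first by apply/cvg_ex; exists l.
near=> h.
have h0 : 0 < h by near: h; exact: nbhs_right_gt.
rewrite /GRing.scale/= mulr1 pmulr_rle0 ?invr_gt0// subr_le0; apply: fle.
by rewrite ltrDr.
Unshelve. all: by end_near. Qed.

Lemma is_derive_ge0_left {R : realType} (f : R -> R) (x df : R) :
  is_derive x 1 f df -> (forall y, y < x -> f y <= f x) -> 0 <= df.
Proof.
move=> fdf fle.
have [/cvg_ex[l fl] fdfE] := fdf.
have ldf : l = df by rewrite -fdfE; apply/esym/cvg_lim.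
have /cvg_dnbhs_at_left fl' := fl.
rewrite -ldf -(cvg_lim _ fl')//; apply: limr_ge; first by apply/cvg_ex; exists l.
near=> h.
have h0 : h < 0 by near: h; exact: nbhs_left_lt.
rewrite /GRing.scale/= mulr1 nmulr_rge0 ?invr_lt0// subr_le0; apply: fle.
by rewrite gtrDr.
Unshelve. all: by end_near. Qed.

Lemma is_derive_continuous {R : realType} (f df : R -> R) :
  (forall x : R, is_derive x 1 f (df x)) -> continuous f.
Proof.
move=> fdf x; apply: differentiable_continuous; apply/derivable1_diffP.
by have [] := fdf x.
Qed.

Lemma continuous_integrable_itv {R : realType} (f : R -> R) (a b : R) :
  continuous f -> lebesgue_measure.-integrable `[a, b] (EFin \o f).
Proof.
move=> cf; apply: continuous_compact_integrable; first exact: segment_compact.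
exact: continuous_subspaceT.
Qed.

(** Integration by parts in the form of an inequality: the part of the bound that is an exact
    derivative contributes only boundary values. *)
Lemma integral_le_FTC2 {R : realType} (f w G g : R -> R) (a b : R) :
  a < b -> continuous f -> continuous w -> continuous g ->
  (forall x : R, is_derive x 1 G (g x)) ->
  (forall x, a <= x <= b -> f x <= g x + w x) ->
  (\int[lebesgue_measure]_(x in `[a, b]) (f x)%:E
   <= (G b - G a)%:E + \int[lebesgue_measure]_(x in `[a, b]) (w x)%:E)%E.
Proof.
move=> ab cf cw cg dG fgw.
have cG := is_derive_continuous _ _ dG.
rewrite EFinB -(@continuous_FTC2 _ g G a b ab); last first.
- by move=> x _; rewrite derive1E; exact: derive_val.
- split; [by move=> x _; have [] := dG x| |].
  + exact/cvg_at_right_filter/cG.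
  + exact/cvg_at_left_filter/cG.
- exact: continuous_subspaceT.
rewrite -integralD//; [|exact: continuous_integrable_itv..].
apply: le_integral => //.
- exact: continuous_integrable_itv.
- by apply: integrableD => //; exact: continuous_integrable_itv.
- by move=> x; rewrite inE/= in_itv/= lee_fin; exact: fgw.
Qed.

Lemma ge0_integral_split0 {R : realType} (f : R -> R) (r : R) : 0 < r ->
  continuous f -> (forall x, 0 <= f x) ->
  (\int[lebesgue_measure]_(x in `[(- r)%R, r]) (f x)%:E =
   \int[lebesgue_measure]_(x in `[(- r)%R, 0%R]) (f x)%:E +
   \int[lebesgue_measure]_(x in `[0%R, r]) (f x)%:E)%E.
Proof.
move=> r0 cf f0.
have mf D : measurable_fun D (EFin \o f).
  apply/measurable_EFinP; apply: measurable_funTS.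
  exact: continuous_measurable_fun.
(* The pieces must be disjoint, so the right one is first half-open at 0; adding the null point 0
   closes it again at the end. *)
rewrite (@itv_bndbnd_setU _ _ _ (BRight 0)) ?bnd_simp//; [|lra|lra].
rewrite ge0_integral_setU//=; last 3 first.
- exact: mf.
- by move=> x _; rewrite lee_fin.
- by apply/disj_setPS => x/=; rewrite !in_itv/= => -[/andP[_ ?] /andP[? _]]; lra.
by rewrite integral_itv_obnd_cbnd//; exact: mf.
Qed.

(** * Integration against the radial cut-off *)

Lemma radial_cutoff_vanishes {R : realType} (r : R) (eta : R -> R) (x : R) :
  radial_cutoff r eta -> 2 * r <= `|x| -> eta x = 0.
Proof.
move=> [_ eta_supp _ _ _] rx; apply: contrapT => /eqP etax.
have := eta_supp _ (@subset_closure _ [set y | eta y != 0] x etax).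
by rewrite /= in_itv/= -ltr_norml ltNge rx.
Qed.

(** Passing to a compact interval makes continuous functions integrable and the fundamental theorem
    of calculus available. *)
Lemma integral_cutoff {R : realType} (r : R) (eta f : R -> R) :
  radial_cutoff r eta -> (forall x, eta x = 0 -> f x = 0) ->
  (\int[lebesgue_measure]_x (f x)%:E =
   \int[lebesgue_measure]_(x in `[(- (2 * r))%R, (2 * r)%R]) (f x)%:E)%E.
Proof.
move=> etaP f0; rewrite [RHS]integral_mkcond; apply: eq_integral => x _.
rewrite patchE; case: ifPn => //; rewrite notin_setE/= in_itv/= -ler_norml.
move=> /negP; rewrite -ltNge => /ltW /(radial_cutoff_vanishes _ _ _ etaP) /f0.
by move=> ->.
Qed.

Lemma smooth_is_derive {R : realType} (f : R -> R) : smooth f ->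
  (forall x : R, is_derive x 1 f (derive1 f x)) /\ continuous (derive1 f).
Proof.
move=> sf; split=> x; last first.
  by apply: differentiable_continuous; apply/derivable1_diffP; exact: (sf 1%N).
by rewrite derive1E; apply/derivableP; exact: (sf 0%N).
Qed.

(* On [0 <= x], where [eta' <= 0], the bound [v <= M] gives
   [eta v' <= (eta (v - M))'], and symmetrically with [v + M] on [x <= 0]; no
   integral of [|eta'|] is needed. *)
Lemma integral_cutoff_derive_le {R : realType} (r M : R)
    (eta v dv f w : R -> R) :
  0 < r -> radial_cutoff r eta ->
  (forall x : R, is_derive x 1 v (dv x)) -> continuous dv ->
  (forall x, `|v x| <= M) ->
  continuous f -> (forall x, 0 <= f x) -> (forall x, eta x = 0 -> f x = 0) ->
  continuous w -> (forall x, 0 <= w x) -> (forall x, eta x = 0 -> w x = 0) ->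
  (forall x, f x <= eta x * dv x + w x) ->
  (\int[lebesgue_measure]_x (f x)%:E
   <= (2 * M)%:E + \int[lebesgue_measure]_x (w x)%:E)%E.
Proof.
move=> r0 etaP v_dv cdv vM cf f0 feta cw w0 weta fle.
have [eta_smooth _ eta01 eta1 eta_radial] := etaP.
have [deta cdeta] := smooth_is_derive eta eta_smooth.
have cv := is_derive_continuous _ _ v_dv.
have ceta := is_derive_continuous _ _ deta.
have r20 : 0 < 2 * r by lra.
rewrite !(integral_cutoff _ _ _ etaP)// !ge0_integral_split0//.
pose g (c x : R) := eta x * dv x + (v x + c) * derive1 eta x.
have dG (c x : R) : is_derive x 1 (fun y => eta y * (v y + c)) (g c x).
  have dvc : is_derive x 1 (fun y => v y + c) (dv x + 0).
    exact: (is_deriveD (v_dv x) (is_derive_cst (c : R) (x : R) (1 : R))).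
  have /is_derive_eq := is_deriveM (deta x) dvc; apply.
  by rewrite /g /GRing.scale/= addr0.
have cg c : continuous (g c).
  move=> x; apply: cvgD; first by apply: cvgM; [exact: ceta|exact: cdv].
  apply: cvgM; last exact: cdeta.
  by apply: cvgD; [exact: cv|exact: cvg_cst].
have eta0 : eta 0 = 1 by apply: eta1; lra.
have etaN : eta (- (2 * r)) = 0.
  by apply: radial_cutoff_vanishes etaP _; rewrite normrN ger0_norm// ltW.
have etaP2 : eta (2 * r) = 0.
  by apply: radial_cutoff_vanishes etaP _; rewrite ger0_norm// ltW.
have Nr0 : - (2 * r) < 0 by lra.
have L := integral_le_FTC2 _ _ _ _ _ _ Nr0 cf cw (cg M) (dG M).
have U := integral_le_FTC2 _ _ _ _ _ _ r20 cf cw (cg (- M)) (dG (- M)).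
(* The constant [2 * M] is the sum of the two boundary terms at 0, where [eta] is 1; the outer
   endpoints contribute nothing since [eta] vanishes there. *)
rewrite [leRHS](_ : _ = ((v 0 + M)%:E + \int[lebesgue_measure]_(x in `[(- (2 * r))%R, 0%R]) (w x)%:E)
  + ((M - v 0)%:E + \int[lebesgue_measure]_(x in `[0%R, (2 * r)%R]) (w x)%:E))%E; last first.
  rewrite [RHS]addeACA -EFinD; congr (_%:E + _)%E; ring.
apply: leeD.
- have -> : v 0 + M = eta 0 * (v 0 + M) - eta (- (2 * r)) * (v (- (2 * r)) + M).
    by rewrite eta0 etaN; ring.
  apply: L => x /andP[_ x0].
  apply: (le_trans (fle x)); rewrite lerD2r lerDl mulr_ge0//.
    by have := vM x; rewrite ler_norml => /andP[]; lra.
  apply: (is_derive_ge0_left _ _ _ (deta x)) => y yx; apply: eta_radial.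
  by rewrite !ler0_norm; lra.
- have -> : M - v 0 = eta (2 * r) * (v (2 * r) - M) - eta 0 * (v 0 - M).
    by rewrite eta0 etaP2; ring.
  apply: U => x /andP[x0 _].
  apply: (le_trans (fle x)); rewrite lerD2r lerDl mulr_le0//.
    by have := vM x; rewrite ler_norml => /andP[]; lra.
  apply: (is_derive_le0_right _ _ _ (deta x)) => y yx; apply: eta_radial.
  by rewrite !ger0_norm; lra.
Qed.

(** * Pointwise inequalities for the slope defect and for the jump of the indicators *)

(* AM-GM: [(D / c - 1) ^+ 2 >= 0] with [D := c - y], the inequality being
   trivial for [y >= c]. *)
Lemma one_le_slope_defect {R : realType} (c y : R) : 0 < c ->
  1 <= 2 / c * y + (c ^+ 2)^-1 * Num.max (- (y - c)) 0 ^+ 2.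
Proof.
move=> c0; pose t := y / c.
have yE : y = t * c by rewrite /t divfK// gt_eqF.
have -> : 2 / c * y = 2 * t by rewrite /t; ring.
have [cy|yc] := leP c y.
  have t1 : 1 <= t by rewrite /t ler_pdivlMr// mul1r.
  have : 0 <= (c ^+ 2)^-1 * Num.max (- (y - c)) 0 ^+ 2.
    by rewrite mulr_ge0// ?invr_ge0 ?sqr_ge0.
  lra.
rewrite max_l; last by lra.
rewrite -exprVn -exprMn (_ : c^-1 * - (y - c) = 1 - t).
  by have := sqr_ge0 t; lra.
by rewrite yE; field; rewrite gt_eqF.
Qed.

Lemma indicator_jump_le {R : realType} (a b lam mu s : R) : 0 < s ->
  `|(lam < a)%R%:R - (mu < b)%R%:R| <=
    plateau ((a - lam) / s) + 2 / s ^+ 2 * ((a - b) ^+ 2 + (lam - mu) ^+ 2).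
Proof.
move=> s0.
have s20 : 0 < s ^+ 2 by rewrite exprn_gt0.
have p0 := plateau_ge0 ((a - lam) / s).
have q0 : 0 <= 2 / s ^+ 2 * ((a - b) ^+ 2 + (lam - mu) ^+ 2).
  by rewrite mulr_ge0 ?divr_ge0 ?addr_ge0 ?sqr_ge0// ltW.
have jump1 : `|(lam < a)%R%:R - (mu < b)%R%:R| <= 1 :> R.
  by case: (lam < a); case: (mu < b);
    rewrite /= ?subrr ?subr0 ?sub0r ?normrN ?normr0 ?normr1.
have [near_lam|far] := leP `|a - lam| s.
  rewrite plateau1; first by lra.
  by rewrite normrM normfV (gtr0_norm s0) ler_pdivrMr// mul1r.
suff : (lam < a) != (mu < b) -> 1 <= 2 / s ^+ 2 * ((a - b) ^+ 2 + (lam - mu) ^+ 2).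
  case: eqVneq => [-> _|_ /(_ isT)]; last by lra.
  by rewrite subrr normr0 addr_ge0.
move=> sep; rewrite mulrAC ler_pdivlMr// mul1r.
(* When the indicators differ, [a - lam] and [b - mu] lie on opposite sides of 0, so their distance
   is at least the norm of [a - lam], which exceeds [s]. *)
have gap : s <= `|(a - b) - (lam - mu)|.
  move: sep far; case: (ltP lam a) => ?; case: (ltP mu b) => ? //= _.
    by rewrite gtr0_norm ?ger0_norm; lra.
  by rewrite ler0_norm ?ler0_norm; lra.
have : s ^+ 2 <= `|(a - b) - (lam - mu)| ^+ 2 by rewrite lerXn2r ?nnegrE// ltW.
rewrite real_normK ?num_real//.
(* This is [(x - y) ^+ 2 <= 2 * (x ^+ 2 + y ^+ 2)], the source of the factor 2 in the statement. *)
have := sqr_ge0 ((a - b) + (lam - mu)); nra.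
Qed.

(** * Regularity of the defect, the layer function and the middle range *)

Lemma slope_defect_continuous {R : realType} (c h : R) (u : R -> R) :
  continuous (derive1 u) -> continuous (slope_defect c h u).
Proof.
move=> cdu.
have caff : continuous (fun x => - (Num.sqrt h * derive1 u x - c)).
  move=> x; apply: cvgN; apply: cvgB; last exact: cvg_cst.
  by apply: cvgMr; exact: cdu.
by move=> x; exact: continuous_max (caff x) (@cst_continuous _ _ 0 x).
Qed.

Lemma plateau_layer_continuous {R : realType} (u : R -> R) (lam s : R) :
  continuous u -> continuous (fun x => plateau ((u x - lam) / s)).
Proof.
move=> cu x; apply: (@continuous_comp _ _ _ (fun x => (u x - lam) / s) plateau).
  apply: cvgMl; apply: cvgB; [exact: cu|exact: cvg_cst].
exact: plateau_continuous.
Qed.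

(** The prefactor [s] cancels the [s^-1] of the chain rule; hence the primitive has size of order
    [k * s] although its derivative carries no factor [s]. *)
Lemma is_derive_plateau_layer {R : realType} (u du : R -> R) (k lam s x : R) :
  s != 0 -> is_derive x 1 u (du x) ->
  is_derive x 1 (fun y => k * s * plateau_primitive ((u y - lam) / s))
    (k * plateau ((u x - lam) / s) * du x).
Proof.
move=> s0 u_du.
have inner : is_derive x 1 (fun y => (u y - lam) / s) (s^-1 * du x).
  have /is_derive_eq := is_deriveZ s^-1
    (is_deriveB u_du (is_derive_cst (lam : R) (x : R) (1 : R))).
  move=> /(_ (s^-1 * du x)); rewrite subr0 => /(_ erefl).
  by congr (is_derive _ _ _ _); apply/funext => y; rewrite /GRing.scale/= mulrC.
have /is_derive_eq := is_deriveZ (k * s)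
  (is_derive1_comp (is_derive_plateau_primitive _) inner).
apply; rewrite /GRing.scale/=; field.
exact: s0.
Qed.

Lemma measurable_midrange {R : realType} (u : R -> R) : continuous u ->
  measurable (midrange u).
Proof.
move=> cu.
have -> : midrange u = u @^-1` `[3^-1, 2 / 3].
  by apply/seteqP; split=> x; rewrite /= in_itv.
rewrite -[X in measurable X]setTI.
exact: continuous_measurable_fun.
Qed.

(** * The estimate on the transition layer *)

Lemma transition_layer_le {R : realType} (c h r lam s : R) (u eta : R -> R) :
  0 < c -> 0 < r -> smooth u -> `|lam - 2^-1| < 8^-1 ->
  radial_cutoff r eta -> 0 < s -> s < 48^-1 ->
  (\int[lebesgue_measure]_x (eta x * plateau ((u x - lam) / s))%:E
   <= (6 * Num.sqrt h / c * s)%:E + ((c ^+ 2)^-1)%:E *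
      \int[lebesgue_measure]_(x in midrange u) (eta x * slope_defect c h u x ^+ 2)%:E)%E.
Proof.
move=> c0 r0 usmooth lam12 etaP s0 s48.
have [du cdu] := smooth_is_derive u usmooth.
have cu := is_derive_continuous _ _ du.
have [eta_smooth _ eta01 _ _] := etaP.
have [deta _] := smooth_is_derive eta eta_smooth.
have ceta := is_derive_continuous _ _ deta.
have eta0 x : 0 <= eta x by have /andP[] := eta01 x.
pose phi x := plateau ((u x - lam) / s).
have phi0 x : 0 <= phi x by exact: plateau_ge0.
have cphi : continuous phi by exact: plateau_layer_continuous.
pose D x := slope_defect c h u x.
have cD : continuous D by exact: slope_defect_continuous.
have cD2 : continuous (fun x => D x ^+ 2).
  by move=> x; exact: (continuousM (cD x) (cD x)).
pose k : R := 2 * Num.sqrt h / c.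
have k0 : 0 <= k by rewrite /k divr_ge0 ?mulr_ge0 ?sqrtr_ge0// ltW.
have c20 : 0 <= (c ^+ 2)^-1 by rewrite invr_ge0 sqr_ge0.
pose etaD x := eta x * D x ^+ 2.
have etaD0 x : 0 <= etaD x by rewrite mulr_ge0 ?sqr_ge0.
have cetaD : continuous etaD by move=> x; apply: cvgM; [exact: ceta|exact: cD2].
(* Keeping the factor [phi] confines the remainder to the layer, so that its integral can later be
   bounded by one over the middle range only. *)
pose w x := (c ^+ 2)^-1 * (etaD x * phi x).
have w0 x : 0 <= w x by exact: mulr_ge0 c20 (mulr_ge0 (etaD0 x) (phi0 x)).
have cw : continuous w.
  by move=> x; apply: cvgMr; apply: cvgM; [exact: cetaD|exact: cphi].
have cf : continuous (fun x => eta x * phi x).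
  by move=> x; exact: (continuousM (ceta x) (cphi x)).
have cdv : continuous (fun x => k * phi x * derive1 u x).
  by move=> x; apply: cvgM; [apply: cvgMr; exact: cphi|exact: cdu].
have dv (x : R) : is_derive x 1 (fun x => k * s * plateau_primitive ((u x - lam) / s))
    (k * phi x * derive1 u x).
  exact: (is_derive_plateau_layer u _ k lam s x (lt0r_neq0 s0) (du x)).
have vM x : `|k * s * plateau_primitive ((u x - lam) / s)| <= k * s * (3 / 2).
  have ks0 : 0 <= k * s by rewrite mulr_ge0// ltW.
  by rewrite normrM ger0_norm// ler_wpM2l// plateau_primitive_bound.
have f0 x : 0 <= eta x * phi x by rewrite mulr_ge0.
have feta x : eta x = 0 -> eta x * phi x = 0 by move=> ->; rewrite mul0r.
have weta x : eta x = 0 -> w x = 0.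
  by move=> etax; rewrite /w /etaD etax !mul0r mulr0.
have fle x : eta x * phi x <= eta x * (k * phi x * derive1 u x) + w x.
  have -> : eta x * (k * phi x * derive1 u x) + w x = eta x * phi x *
      (2 / c * (Num.sqrt h * derive1 u x) + (c ^+ 2)^-1 * D x ^+ 2).
    by rewrite /w /etaD /k; ring.
  by rewrite ler_peMr//; exact: one_le_slope_defect.
have := integral_cutoff_derive_le _ _ _ _ _ _ _
  r0 etaP dv cdv vM cf f0 feta cw w0 weta fle.
move/le_trans; apply.
(* The boundary term is [2 * (k * s * (3 / 2)) = 3 * k * s], with [k = 2 * Num.sqrt h / c]. *)
apply: leeD; first by rewrite lee_fin /k; lra.
have mmid := measurable_midrange u cu.
have mE A (F : R -> R) : continuous F -> measurable_fun A (EFin \o F).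
  by move=> cF; apply/measurable_EFinP; apply: measurable_funTS;
    exact: continuous_measurable_fun.
rewrite -ge0_integralZl_EFin//; last 2 first.
- by move=> x _; rewrite lee_fin; exact: etaD0.
- exact: mE.
rewrite [leRHS]integral_mkcond; apply: ge0_le_integral => //.
- by move=> x _; rewrite lee_fin.
- exact: mE.
- apply/(measurable_restrictT _ _).1 => //.
  by apply: measurable_funeM; exact: mE.
move=> x _; rewrite patchE; case: ifPn => [_|].
  by rewrite -EFinM lee_fin ler_wpM2l// ler_piMr// plateau_le1.
(* If [u x] were within [2 * s < 1/24] of [lam], it would be within [1/8 + 1/24 = 1/6] of [1/2],
   hence in the middle range. So outside that range the trapezoid vanishes; this is where the
   threshold 1/48 comes from. *)
rewrite notin_setE/= /midrange/= => nmid.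
rewrite lee_fin /w /phi plateau0 ?mulr0//.
rewrite normrM normfV (gtr0_norm s0) ler_pdivlMr// leNgt.
apply/negP; rewrite ltr_norml => /andP[? ?]; apply: nmid.
move: lam12; rewrite ltr_norml => /andP[? ?].
by apply/andP; split; lra.
Qed.

(** * Mass of the cut-off and assembly of the estimate *)

Lemma integral_cutoff_le {R : realType} (r : R) (eta : R -> R) :
  0 < r -> radial_cutoff r eta ->
  (\int[lebesgue_measure]_x (eta x)%:E <= (4 * r)%:E)%E.
Proof.
move=> r0 etaP; have [eta_smooth _ eta01 _ _] := etaP.
have [deta _] := smooth_is_derive eta eta_smooth.
have ceta := is_derive_continuous _ _ deta.
rewrite (integral_cutoff _ _ _ etaP)//.
apply: (@le_trans _ _ (\int[lebesgue_measure]_(x in `[(- (2 * r))%R, (2 * r)%R])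
    cst 1%E x)%E).
  apply: ge0_le_integral => //.
  - by move=> x _; rewrite lee_fin; have /andP[] := eta01 x.
  - apply/measurable_EFinP; apply: measurable_funTS.
    exact: continuous_measurable_fun.
  - by move=> x _; rewrite lee_fin; have /andP[] := eta01 x.
rewrite integral_cst//= mul1e lebesgue_measure_itv/= lte_fin.
by case: ifPn => _; rewrite ?lee_fin; lra.
Qed.

Theorem lemma1p19 (R : realType) (cbar : R) (hcbar : admissible_slope cbar) :
  exists C : R, 0 < C /\
    forall (h r : R) (u ut : R -> R) (lam lamt : R) (eta : R -> R) (s : R),
      0 < h -> 0 < r -> smooth u -> smooth ut ->
      `|lam - 2^-1| < 8^-1 ->
      radial_cutoff r eta ->
      0 < s -> s < C^-1 ->
      let mu := @lebesgue_measure R in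
      let chi : R -> R := \1_[set x | lam < u x] in
      let chit : R -> R := \1_[set x | lamt < ut x] in
      (((Num.sqrt h)^-1)%:E * \int[mu]_x (eta x * `|chi x - chit x|)%:E
       <= C%:E *
          (((Num.sqrt h)^-1)%:E *
             \int[mu]_(x in midrange u) (eta x * slope_defect cbar h u x ^+ 2)%:E
           + s%:E
           + ((s ^+ 2)^-1 * (Num.sqrt h)^-1)%:E *
             \int[mu]_x (eta x * (u x - ut x) ^+ 2)%:E
           + (r / s ^+ 2 * ((lam - lamt) ^+ 2 / Num.sqrt h))%:E))%E.

Proof.
have [c0 _] := hcbar; set c := cbar in c0 *.
have c2V : 0 <= (c ^+ 2)^-1 by rewrite invr_ge0 sqr_ge0.
have cV : 0 <= 6 / c by rewrite divr_ge0// ltW.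
(* The summand 48 turns [s < C^-1] into [s < 48^-1] and also covers the numerical factors 2 and 8 of
   the last two terms; [6 / c] serves the term [s], and [(c ^+ 2)^-1] the defect integral. *)
pose C : R := 48 + 6 / c + (c ^+ 2)^-1.
have C48 : 48 <= C by rewrite /C; lra.
have C0 : 0 < C by lra.
exists C; split=> // h r u ut lam lamt eta s h0 r0 usmooth utsmooth lam12 etaP s0 sC.
cbv zeta; set mu := lebesgue_measure.
pose chi : R -> R := \1_[set x | lam < u x].
pose chit : R -> R := \1_[set x | lamt < ut x].
have s48 : s < 48^-1 by apply: (lt_le_trans sC); rewrite lef_pV2 ?posrE.
have [du _] := smooth_is_derive u usmooth.
have cu := is_derive_continuous _ _ du.
have [dut _] := smooth_is_derive ut utsmooth.
have cut := is_derive_continuous _ _ dut.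
have [eta_smooth _ eta01 _ _] := etaP.
have [deta _] := smooth_is_derive eta eta_smooth.
have ceta := is_derive_continuous _ _ deta.
have eta0 x : 0 <= eta x by have /andP[] := eta01 x.
have layer := transition_layer_le c h r lam s u eta c0 r0 usmooth lam12 etaP s0 s48.
set I1 := (\int[lebesgue_measure]_(x in midrange u) _)%E in layer.
have etaE := integral_cutoff_le r eta r0 etaP.
pose L := (lam - lamt) ^+ 2.
pose q := 2 / s ^+ 2.
have q0 : 0 <= q by rewrite divr_ge0 ?sqr_ge0.
have L0 : 0 <= L by exact: sqr_ge0.
pose phi x := plateau ((u x - lam) / s).
have phi0 x : 0 <= phi x by exact: plateau_ge0.
have cphi : continuous phi by exact: plateau_layer_continuous.
pose f x := eta x * phi x.
pose g x := eta x * (u x - ut x) ^+ 2.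
have f0 x : 0 <= f x by exact: mulr_ge0.
have g0 x : 0 <= g x by rewrite mulr_ge0 ?sqr_ge0.
have cf : continuous f by move=> x; exact: (continuousM (ceta x) (cphi x)).
have cg : continuous g.
  move=> x; have cd := continuousB (cu x) (cut x).
  exact: (continuousM (ceta x) (continuousM cd cd)).
have mE (F : R -> R) : continuous F -> measurable_fun setT (EFin \o F).
  by move=> cF; apply/measurable_EFinP; exact: continuous_measurable_fun.
have mchi (v : R -> R) a : continuous v ->
    measurable_fun setT (\1_[set x | a < v x] : R -> R).
  move=> cv; apply: measurable_indic; apply: open_measurable.
  exact: (open_comp _ (@open_gt R a)).
set I3 := (\int[mu]_x (eta x * (u x - ut x) ^+ 2)%:E)%E.
have I1_ge0 : (0 <= I1)%E.
  by apply: integral_ge0 => x _; rewrite lee_fin mulr_ge0 ?sqr_ge0.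
have I3_ge0 : (0 <= I3)%E by apply: integral_ge0 => x _; rewrite lee_fin; exact: g0.
have main : (\int[mu]_x (eta x * `|chi x - chit x|)%:E <=
    ((6 * Num.sqrt h / c * s)%:E + ((c ^+ 2)^-1)%:E * I1)
    + (q%:E * I3 + (q * L)%:E * (4 * r)%:E))%E.
  (* The majorant is [eta] times the bound of [indicator_jump_le], split into the layer, the
     difference of [u] and [ut], and the difference of the thresholds. *)
  apply: (@le_trans _ _ (\int[mu]_x ((f x)%:E + (q%:E * (g x)%:E + (q * L)%:E * (eta x)%:E)))%E).
    apply: ge0_le_integral => //.
    - by move=> x _; rewrite lee_fin mulr_ge0.
    - apply/measurable_EFinP; apply: measurable_funM.
        exact: continuous_measurable_fun.
      apply: measurableT_comp => //; apply: measurable_funB; exact: mchi.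
    - apply: emeasurable_funD; first exact: mE.
      by apply: emeasurable_funD; apply: measurable_funeM; exact: mE.
    move=> x _; rewrite -!EFinM -!EFinD lee_fin.
    rewrite (_ : f x + _ = eta x * (phi x + q * ((u x - ut x) ^+ 2 + L))); last first.
      by rewrite /f /g; ring.
    rewrite ler_wpM2l// /chi /chit !indicE !mem_setE/=.
    exact: indicator_jump_le.
  rewrite ge0_integralD//=; last 4 first.
  - by move=> x _; rewrite lee_fin.
  - exact: mE.
  - by move=> x _; rewrite adde_ge0// mule_ge0// lee_fin// mulr_ge0.
  - by apply: emeasurable_funD; apply: measurable_funeM; exact: mE.
  apply: leeD; first exact: layer.
  rewrite ge0_integralD//=; last 4 first.
  - by move=> x _; rewrite mule_ge0// lee_fin.
  - by apply: measurable_funeM; exact: mE.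
  - by move=> x _; rewrite mule_ge0// lee_fin// mulr_ge0.
  - by apply: measurable_funeM; exact: mE.
  rewrite !ge0_integralZl_EFin//; last 5 first.
  - by move=> x _; rewrite lee_fin.
  - exact: mE.
  - exact: mulr_ge0.
  - by move=> x _; rewrite lee_fin.
  - exact: mE.
  by apply: leeD => //; apply: lee_wpmul2l => //; rewrite lee_fin mulr_ge0.
have sh0 : 0 < Num.sqrt h by rewrite sqrtr_gt0.
pose k := (Num.sqrt h)^-1.
have k0 : 0 <= k by rewrite invr_ge0 ltW.
have s2V : 0 <= (s ^+ 2)^-1 by rewrite invr_ge0 sqr_ge0.
have rL0 : 0 <= r / s ^+ 2 * (L / Num.sqrt h).
  exact: mulr_ge0 (divr_ge0 (ltW r0) (sqr_ge0 s)) (divr_ge0 L0 (ltW sh0)).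
apply: (le_trans (lee_wpmul2l _ main)); first by rewrite lee_fin.
(* Products are distributed over sums of extended reals by nonnegativity of the summands, so
   finiteness of the integrals need not be established. *)
have kI1_ge0 : (0 <= k%:E * I1)%E by rewrite mule_ge0.
have kI3_ge0 : (0 <= ((s ^+ 2)^-1 * k)%:E * I3)%E by rewrite mule_ge0// lee_fin mulr_ge0.
have sE : (0 <= s%:E)%E by rewrite lee_fin ltW.
have rLE : (0 <= (r / s ^+ 2 * (L / Num.sqrt h))%:E)%E by rewrite lee_fin.
rewrite [leRHS]ge0_muleDr ?adde_ge0// [X in (_ <= X + _)%E]ge0_muleDr ?adde_ge0//.
rewrite [X in (_ <= X + _ + _)%E]ge0_muleDr//.
have A0 : 0 <= 6 * Num.sqrt h / c * s.
  by rewrite !mulr_ge0 ?invr_ge0// ltW.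
have c2I1 : (0 <= ((c ^+ 2)^-1)%:E * I1)%E by rewrite mule_ge0.
have qI3 : (0 <= q%:E * I3)%E by rewrite mule_ge0.
have qLr : (0 <= (q * L)%:E * (4 * r)%:E)%E.
  by rewrite mule_ge0// lee_fin mulr_ge0// ltW.
rewrite -[X in (_ <= X)%E]addeA.
rewrite [leLHS]ge0_muleDr ?adde_ge0//; apply: leeD.
  rewrite ge0_muleDr ?lee_fin// addeC; apply: leeD.
    rewrite muleCA; apply: lee_wpmul2r => //.
    by rewrite lee_fin /C; lra.
  (* The [Num.sqrt h] gained from the boundary term cancels the prefactor, leaving a multiple of [s]
     independent of [h]. *)
  rewrite -!EFinM lee_fin (_ : k * _ = 6 / c * s).
    by rewrite ler_wpM2r ?(ltW s0)// /C; lra.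
  by rewrite /k; field; rewrite !gt_eqF.
rewrite ge0_muleDr//; apply: leeD.
  rewrite muleA [leRHS]muleA -!EFinM; apply: lee_wpmul2r => //.
  rewrite lee_fin (_ : k * q = 2 * ((s ^+ 2)^-1 * k)); last by rewrite /q; ring.
  by rewrite ler_wpM2r ?mulr_ge0//; lra.
rewrite -!EFinM lee_fin.
(* The 8 is the 2 in [q] times the 4 in the bound [4 * r] for the mass of [eta]. *)
rewrite (_ : k * _ = 8 * (r / s ^+ 2 * (L / Num.sqrt h))); last by rewrite /k /q; ring.
by rewrite ler_wpM2r//; lra.
Qed.
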